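(* Let $A$ be a proper (finite or infinite) subset of $\mathbb X$ and $f\in\mathrm{Dom}_+(\Gamma)$ such that (i) there exists $x_0\notin A$ with $f(x_0)<\inf_{x\in A}f(x)$, and (ii) there is $\epsilon>0$ with $\Gamma f(x)\le-\epsilon$ for all $x\in A^c$. Then $\mathbb E_x(\zeta\mid\tau_A=\infty)<\infty$.
   Context: Let $\mathbb X$ be a countably infinite set and $\Gamma=(\Gamma_{xy})_{x,y\in\mathbb X}$ a matrix with $\Gamma_{xy}\ge0$ for $y\ne x$, $\gamma_x:=\sum_{y\ne x}\Gamma_{xy}$, $\Gamma_{xx}=-\gamma_x$, and $0<\gamma_x<\infty$ for all $x$. Let $P_{xy}=\Gamma_{xy}/\gamma_x$ for $y\neq x$ and $P_{xx}=0$; the discrete-time chain $(\tilde\xi_n)$ with transition matrix $P$ (embedded jump chain) is assumed irreducible. The continuous-time Markov chain $(\xi_t)_{t\ge0}$ with generator $\Gamma$: conditionally on $\tilde\xi$, holding times $\sigma_n$ ($n\ge1$) are independent exponential with parameter $\gamma_{\tilde\xi_{n-1}}$; $J_0=0$, $J_n=\sigma_1+\dots+\sigma_n$; explosion time $\zeta=\lim_n J_n$; $\xi_t=\tilde\xi_n$ on $[J_n,J_{n+1})$ and $\xi_t=\partial$ (cemetery) for $t\ge\zeta$. $\mathbb E_x$ refers to $\xi_0=x$. $\tau_A=\inf\{t\ge0:\xi_t\in A\}$. $\mathrm{Dom}(\Gamma)=\{f:\mathbb X\to\mathbb R:\ \sum_{y\ne x}\Gamma_{xy}|f(y)|<\infty\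 \forall x\}$, $\mathrm{Dom}_+(\Gamma)$ its non-negative elements, $\Gamma f(x)=\sum_{y}\Gamma_{xy}f(y)$. (The conclusion concerns starting points $x$ for which the conditioning event $\{\tau_A=\infty\}$ has positive probability.) *)

(* Defs.v *)
From HB Require Import structures.
From mathcomp Require Import all_boot all_order all_algebra.
From mathcomp Require Import all_classical all_reals all_analysis.
Set Implicit Arguments. Unset Strict Implicit. Unset Printing Implicit Defensive.
Import Order.TTheory GRing.Theory Num.Theory.
Local Open Scope classical_set_scope.
Local Open Scope ring_scope.

Section Defs.
Context {R : realType} {X : countType}.
Implicit Types (G : X -> X -> R) (f : X -> R).

Definition gam G (x : X) : \bar R := (\esum_(y in [set y | y != x]) (G x y)%:E)%E.

(* embedded jump chain: P_xy = Gamma_xy / gamma_x (y <> x), P_xx = 0,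
   where gamma_x = - Gamma_xx (standing assumption) *)
Definition Pjump G (x y : X) : R := if y == x then 0 else G x y / (- G x x).

Definition irreducible_P G : Prop :=
  forall x y : X, exists s : seq X,
    path (fun a b => 0 < Pjump G a b) x s && (last x s == y).

Definition in_Dom G f : Prop :=
  forall x, (\esum_(y in [set y | y != x]) (G x y * `|f y|)%:E < +oo)%E.

(* (Gamma f)(x) = Gamma_xx f(x) + sum_{y<>x} Gamma_xy f(y) (absolutely convergent
   series for f in Dom(Gamma), computed via positive and negative parts) *)
Definition Gamma_apply G f (x : X) : R :=
  G x x * f x
  + (fine (\esum_(y in [set y | y != x]) (G x y * Num.max (f y) 0)%:E)%E
     - fine (\esum_(y in [set y | y != x]) (G x y * Num.max (- f y) 0)%:E)%E).

Definition Jt {T : Type} (sig : nat -> T -> R) (n : nat) (w : T) : R :=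
  \sum_(1 <= k < n.+1) sig k w.

(* explosion time zeta = lim_n J_n (= sup_n J_n, J nondecreasing) *)
Definition zeta {T : Type} (sig : nat -> T -> R) (w : T) : \bar R :=
  ereal_sup (range (fun n => (Jt sig n w)%:E)).

(* xi_t(w) in A: xi_t = tilde_xi_n on [J_n, J_{n+1}); cemetery (not in A) after zeta *)
Definition xi_in {T : Type} (Xt : nat -> T -> X) (sig : nat -> T -> R)
  (A : set X) (t : R) (w : T) : Prop :=
  exists n, Jt sig n w <= t < Jt sig n.+1 w /\ A (Xt n w).

Definition tau {T : Type} (Xt : nat -> T -> X) (sig : nat -> T -> R)
  (A : set X) (w : T) : \bar R :=
  ereal_inf [set t%:E | t in [set t : R | 0 <= t /\ xi_in Xt sig A t w]].

End Defs.

Definition cond_expect {d} {T : measurableType d} {R : realType}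
  (P : probability T R) (Z : T -> \bar R) (B : set T) : \bar R :=
  ((\int[P]_(w in B) Z w) * ((fine (P B))^-1)%:E)%E.

(* (Xt, sig) is the jump chain / holding times of the CTMC with generator G started at x:
   finite-dimensional joint law
   P(Xt_0=z_0,..,Xt_n=z_n, sig_1>t_1,..,sig_n>t_n)
     = 1_{z_0=x} prod_{k<n} P_{z_k z_{k+1}} exp(-gamma_{z_k} t_{k+1}). *)
Definition is_CTMC {d} {T : measurableType d} {R : realType} {X : countType}
  (P : probability T R) (G : X -> X -> R) (x : X)
  (Xt : nat -> T -> X) (sig : nat -> T -> R) : Prop :=
  (forall n (y : X), measurable [set w | Xt n w = y]) /\
  (forall n, measurable_fun setT (sig n)) /\
  (forall (n : nat) (z : nat -> X) (t : nat -> R), (forall k, 0 <= t k) ->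
     P [set w | (forall k, (k <= n)%N -> Xt k w = z k) /\
                (forall k, (1 <= k <= n)%N -> t k < sig k w)]
     = (((z 0%N == x)%:R
         * \prod_(0 <= k < n) (Pjump G (z k) (z k.+1)
                                * expR (- (- G (z k) (z k)) * t k.+1)))%:E)%E).

(* Main.v *)
Require Import Defs.
From HB Require Import structures.
From mathcomp Require Import all_boot all_order all_algebra.
From mathcomp Require Import all_classical all_reals all_analysis measurable_realfun.
From mathcomp Require Import ring lra.
Import Order.TTheory GRing.Theory Num.Theory.
Local Open Scope classical_set_scope.
Local Open Scope ring_scope.

(** Outside [A] the drift condition says [P f <= f - eps / gamma] for the jump
    chain. Iterating it along the chain killed on entering [A], the nonnegative
    function [f] pays at least [eps / gamma_y] for each visit to a state [y], and
    [1 / gamma_y] is, up to a constant, the expected holding time there. Hence the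
    expected total time spent before entering [A] is at most [C * f x / eps], and
    on [tau_A = +oo] this total time is [zeta]. *)

(** * Sums and integrals indexed by a countable type *)

Section CountableSums.
Context {R : realType} {X : countType}.
Local Open Scope ereal_scope.

(** Lets results on series over [nat] apply to sums over [X]: [pickle] is injective, and codes
    outside its range contribute the default [0]. *)
Lemma esum_pickle_inv (a : X -> \bar R) : (forall y, 0 <= a y) ->
  \esum_(y in [set: X]) a y = \sum_(n <oo) oapp a 0 (pickle_inv n).
Proof.
move=> a0; pose b n := oapp a 0 (@pickle_inv X n).
have b0 n : 0 <= b n by rewrite /b; case: pickle_inv => //= y; exact: a0.
rewrite (nneseries_esumT b0).
have -> : \esum_(n in [set: nat]) b n = \esum_(n in range (@pickle X)) b n.
  rewrite [RHS]esum_mkcond; apply: eq_esum => n _; case: ifPn => // /negP nr.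
  rewrite /b; case E: (pickle_inv n) => [y|]//=; exfalso; apply: nr.
  by rewrite inE; exists y => //; have := @pickle_invK X n; rewrite E.
rewrite esum_image; last by move=> y z _ _; exact: (pcan_inj (@pickleK X)).
by apply: eq_esum => y _; rewrite /b pickleK_inv.
Qed.

Lemma esumZl (k : R) (a : X -> \bar R) : (forall y, 0 <= a y) ->
  (0 <= k)%R ->
  \esum_(y in [set: X]) (k%:E * a y) = k%:E * \esum_(y in [set: X]) a y.
Proof.
move=> a0 k0; rewrite !esum_pickle_inv//; last first.
  by move=> y; rewrite mule_ge0// lee_fin.
rewrite -nneseriesZl; last first.
  by move=> n _; case: pickle_inv => //= y; exact: a0.
by apply: eq_eseriesr => n _; case: pickle_inv => //=; rewrite mule0.
Qed.

Lemma ge0_integral_bigcup_countType {d} {T : measurableType d}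
    (mu : measure T R) (F : X -> set T) (h : T -> \bar R) :
  (forall y, measurable (F y)) -> trivIset setT F ->
  measurable_fun setT h -> (forall w, 0 <= h w) ->
  \int[mu]_(w in \bigcup_y F y) h w =
  \esum_(y in [set: X]) \int[mu]_(w in F y) h w.
Proof.
move=> mF tF mh h0; pose F' n := oapp F set0 (@pickle_inv X n).
have -> : \bigcup_y F y = \bigcup_n F' n.
  apply/seteqP; split => [w [y _ Fy]|w [n _]].
    by exists (pickle y) => //; rewrite /F' pickleK_inv.
  by rewrite /F'; case: pickle_inv => //= y Fy; exists y.
rewrite ge0_integral_bigcup//; last first.
- apply/trivIsetP => i j _ _ ij; rewrite /F'.
  case Ei: (pickle_inv i) => [y|] /=; last by rewrite set0I.
  case Ej: (pickle_inv j) => [z|] /=; last by rewrite setI0.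
  move/trivIsetP : tF; apply => //; apply: contra_neq ij => yz.
  have := @pickle_invK X i; have := @pickle_invK X j.
  by rewrite Ei Ej /= yz => <-.
- exact: measurable_funTS.
- by move=> n; rewrite /F'; case: pickle_inv => [y|] /=; [exact: mF|exact: measurable0].
rewrite esum_pickle_inv; last by move=> y; exact: integral_ge0.
apply: eq_eseriesr => n _; rewrite /F'.
by case: pickle_inv => //=; rewrite integral_set0.
Qed.

End CountableSums.

(** * Two integral bounds on a general measure space *)

Section Integral.
Context {R : realType} {d} {T : measurableType d} (mu : measure T R).
Local Open Scope ereal_scope.
Import HBNNSimple.

(* [h1] need not be measurable: its integral is a supremum over the simple
   functions below it, each of which is compared with [h2]. *)
Lemma ae_ge0_le_integral_nonmeasurable (h1 h2 : T -> \bar R) :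
  (forall w, 0 <= h1 w) -> (forall w, 0 <= h2 w) -> measurable_fun setT h2 ->
  {ae mu, forall w, h1 w <= h2 w} ->
  \int[mu]_w h1 w <= \int[mu]_w h2 w.
Proof.
move=> h10 h20 mh2 h12; rewrite ge0_integralTE//.
apply: ge_ereal_sup => _ [h /= hh1 <-]; rewrite -integralT_nnsfun.
apply: ae_ge0_le_integral => //.
- by move=> w _; rewrite lee_fin.
- exact/measurable_EFinP.
- by apply: filterS h12 => w h12 _; exact: le_trans h12.
Qed.

(* The exact value is [p / gm]; the extra factor avoids computing an integral. *)
Lemma integral_le_exponential_tail (E : set T) (S : T -> R) (p gm : R) :
  measurable E -> measurable_fun setT S -> (0 < gm)%R -> (0 <= p)%R ->
  (forall t, (0 <= t)%R ->
    mu (E `&` [set w | (t < S w)%R]) = (p * expR (- gm * t))%:E) ->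
  \int[mu]_(w in E) (Num.max (S w) 0)%:E <=
  (p * (gm^-1 * (1 - expR (-1))^-1))%:E.
Proof.
move=> mE mS gm0 p0 tail.
pose lev (j : nat) := [set w | (j%:R / gm < S w)%R].
have mlev j : measurable (lev j).
  have -> : lev j = setT `&` S @^-1` (`](j%:R / gm)%R, +oo[)%classic.
    by rewrite setTI; apply/seteqP; split => w /=; rewrite in_itv/= andbT.
  exact: mS.
pose g j w := (gm^-1 * \1_(lev j) w)%:E : \bar R.
have g0 j w : 0 <= g j w by rewrite lee_fin mulr_ge0// invr_ge0 ltW.
have mg j : measurable_fun setT (g j).
  by apply/measurable_EFinP/measurable_funM => //; exact: measurable_indic.
(* Rounding [S] up to the grid of mesh [1/gm]. *)
have Sg w : (Num.max (S w) 0)%:E <= \sum_(j <oo) g j w.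
  have [S0|S0] := leP (S w) 0%R; first exact: nneseries_ge0.
  pose N := (Num.truncn (S w * gm)).+1.
  have SN : (S w * gm < N%:R)%R.
    by rewrite /N; exact: truncnS_gt.
  apply: le_trans (nneseries_lim_ge N _) => //.
  (* With the minimum inserted, the inequality holds for every [N], large or not, which makes
     induction on [N] possible. *)
  have -> : (S w = gm^-1 * Num.min (S w * gm) N%:R)%R.
    by rewrite min_l ?(ltW SN)// mulrC mulfK// gt_eqF.
  elim: N {SN} => [|N IH].
    by rewrite big_nil lee_fin min_r ?mulr0// mulr_ge0 ?ltW.
  rewrite big_nat_recr//= {2}/g indicE.
  have [_|/negP wN] := boolP (w \in lev N).
    rewrite mulr1; apply: le_trans (leeD IH (lexx _)).
    rewrite -EFinD lee_fin -[X in (_ <= _ + X)%R]mulr1 -mulrDr.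
    rewrite ler_pM2l ?invr_gt0// -natr1 addr_minl.
    by rewrite le_min !ge_min lerDl ler01 lexx !orbT.
  rewrite mulr0 adde0; apply: le_trans IH.
  have {}wN : (S w * gm <= N%:R)%R.
    rewrite -ler_pdivlMr// leNgt; apply/negP => NS; apply: wN.
    by rewrite inE.
  rewrite lee_fin ler_pM2l ?invr_gt0// [leRHS]min_l//.
  by rewrite ge_min lexx.
apply: (@le_trans _ _ (\int[mu]_(w in E) \sum_(j <oo) g j w)).
  apply: ge0_le_integral => //.
  - by move=> w _; rewrite lee_fin le_max lexx orbT.
  - apply: measurable_funTS; apply/measurable_EFinP.
    exact: measurable_maxr.
  - by apply: measurable_funTS; exact: ge0_emeasurable_sum.
rewrite (integral_nneseries mu mE) => [|n|//]; last exact: measurable_funTS.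
(* Within [E], level [j] has mass [p * expR (- j)], since [gm] times [j / gm] is [j]; hence a
   geometric series of ratio [expR (-1)]. *)
have -> : \sum_(j <oo) \int[mu]_(w in E) g j w =
    \sum_(j <oo) (geometric (p * gm^-1) (expR (-1)) j)%:E.
  apply: eq_eseriesr => j _; rewrite /g.
  under eq_integral do rewrite EFinM.
  rewrite ge0_integralZl_EFin//; first last.
  - by rewrite invr_ge0 ltW.
  - by apply/measurable_EFinP/measurable_funTS; exact: measurable_indic.
  rewrite integral_indic// setIC tail; last first.
    by rewrite divr_ge0// ltW.
  rewrite -EFinM /geometric; congr (_%:E) => /=.
  rewrite -expRM_natl mulrCA mulrA; congr (_ * expR _)%R.
  by field; rewrite gt_eqF.
apply: lime_le.
  apply: is_cvg_nneseries => n _ _; rewrite lee_fin geometric_ge0//.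
  by rewrite mulr_ge0// invr_ge0 ltW.
apply: nearW => n; rewrite sumEFin lee_fin.
rewrite mulrA; apply: geometric_le_lim.
- by rewrite mulr_ge0// invr_ge0 ltW.
- by rewrite expR_gt0.
- by rewrite ger0_norm ?expR_ge0// -expR0 ltr_expR; lra.
Qed.

End Integral.

(** * One-step averages under the jump chain *)

Section JumpKernel.
Context {R : realType} {X : countType} (G : X -> X -> R).
Context (Goff : forall x y : X, y != x -> 0 <= G x y).
Context (Ggam : forall x : X, gam G x = (- G x x)%:E).
Context (Gpos : forall x : X, 0 < - G x x).
Local Open Scope ereal_scope.

Lemma Pjump_ge0 x y : (0 <= Pjump G x y)%R.
Proof.
rewrite /Pjump; case: ifPn => // yx.
by rewrite divr_ge0 ?Goff// ltW.
Qed.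

Lemma esum_Pjump_mul x (u : X -> R) : (forall y, 0 <= u y)%R ->
  \esum_(y in [set: X]) (Pjump G x y * u y)%:E =
  ((- G x x)^-1)%:E * \esum_(y in [set y | y != x]) (G x y * u y)%:E.
Proof.
move=> u0; rewrite [in RHS]esum_mkcond -esumZl.
- apply: eq_esum => y _; rewrite /Pjump; case: eqVneq => yx.
    by rewrite memNset /= ?yx ?eqxx// mul0r mule0.
  by rewrite mem_set//= -EFinM mulrAC mulrC.
- by move=> y; case: ifPn => //; rewrite inE/= => yx; rewrite lee_fin mulr_ge0// Goff.
- by rewrite invr_ge0 ltW.
Qed.

Lemma esum_Pjump x : \esum_(y in [set: X]) (Pjump G x y)%:E = 1.
Proof.
transitivity (\esum_(y in [set: X]) (Pjump G x y * 1)%:E).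
  by apply: eq_esum => y _; rewrite mulr1.
rewrite esum_Pjump_mul//.
under eq_esum do rewrite mulr1.
have := Ggam x; rewrite /gam => ->.
by rewrite -EFinM mulVf// gt_eqF.
Qed.

(** This is the drift inequality divided by [- G x x]. As [f] is non-negative its negative part
    drops out, and [in_Dom] makes the remaining sum finite, so that [fine] loses nothing. *)
Lemma Pjump_drift (f : X -> R) (eps : R) x :
  (forall y, 0 <= f y)%R -> in_Dom G f -> (Gamma_apply G f x <= - eps)%R ->
  \esum_(y in [set: X]) (Pjump G x y * f y)%:E <= (f x - eps / - G x x)%:E.
Proof.
move=> f0 fD; rewrite esum_Pjump_mul// /Gamma_apply.
have -> : \esum_(y in [set y | y != x]) (G x y * Num.max (- f y) 0)%:E = 0 :> \bar R.
  by apply: esum1 => y _; rewrite max_r ?mulr0// oppr_le0.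
have -> : \esum_(y in [set y | y != x]) (G x y * Num.max (f y) 0)%:E =
    \esum_(y in [set y | y != x]) (G x y * f y)%:E :> \bar R.
  by apply: eq_esum => y _; rewrite max_l.
have : \esum_(y in [set y | y != x]) (G x y * f y)%:E < +oo :> \bar R.
  have := fD x; congr (_ < _); apply: eq_esum => y _.
  by rewrite ger0_norm.
have : 0 <= \esum_(y in [set y | y != x]) (G x y * f y)%:E :> \bar R.
  by apply: esum_ge0 => y yx; rewrite lee_fin mulr_ge0// Goff.
case: (\esum_(y in _) _) => [s| |]//= _ _.
rewrite subr0 -EFinM lee_fin => Gf.
have g0 := Gpos x; have gN0 : (- G x x != 0)%R by rewrite gt_eqF.
rewrite mulrC -[X in (_ <= X - _)%R](mulfK gN0) -mulrBl.
rewrite ler_pM2r ?invr_gt0//; lra.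
Qed.

End JumpKernel.

(** * Integration along cylinder events of the chain *)

Section Chain.
Context {R : realType} {X : countType} (G : X -> X -> R) (x : X).
Context {d} {T : measurableType d} (P : probability T R).
Context (Xt : nat -> T -> X) (sig : nat -> T -> R).
Context (Goff : forall x y : X, y != x -> 0 <= G x y).
Context (Ggam : forall x : X, gam G x = (- G x x)%:E).
Context (Gpos : forall x : X, 0 < - G x x).
Context (chain : is_CTMC P G x Xt sig).
Local Open Scope ereal_scope.

(** Positivity of the holding times is built in because [is_CTMC] prescribes probabilities of events
    with strict bounds [t k < sig k]; taking [t] zero gives exactly the cylinders. *)
Definition cylinder (z : nat -> X) (m : nat) : set T :=
  [set w | (forall k, (k <= m)%N -> Xt k w = z k) /\
           (forall k, (1 <= k <= m)%N -> (0 < sig k w)%R)].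

Definition path_weight (z : nat -> X) (m : nat) : R :=
  ((z 0%N == x)%:R * \prod_(0 <= k < m) Pjump G (z k) (z k.+1))%R.

(** Paths are total functions on [nat], so [y] is repeated forever; on cylinders of length [m.+1]
    only its occurrence at time [m.+1] counts. *)
Definition extend (z : nat -> X) (m : nat) (y : X) (k : nat) : X :=
  if (k <= m)%N then z k else y.

Lemma path_weight_ge0 z m : (0 <= path_weight z m)%R.
Proof.
by rewrite mulr_ge0// big_mkord prodr_ge0// => k _; exact: Pjump_ge0.
Qed.

Lemma path_weight_extend z m y :
  path_weight (extend z m y) m.+1 = (path_weight z m * Pjump G (z m) y)%R.
Proof.
rewrite /path_weight big_nat_recr//= mulrA /extend leqnn ltnn; congr (_ * _ * _)%R.
by apply: eq_big_nat => k /andP[_ km]; rewrite km ltnW.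
Qed.

Lemma measurable_visit (B : set X) n : measurable [set w | B (Xt n w)].
Proof.
have -> : [set w | B (Xt n w)] =
    \bigcup_y (if y \in B then [set w | Xt n w = y] else set0).
  apply/seteqP; split => [w Bw|w [y _]].
    by exists (Xt n w) => //; rewrite mem_set.
  by case: ifPn => //; rewrite inE => By /= ->.
apply: countable_bigcupT_measurable => [|y]; first exact: countableP.
by case: ifPn => _; [exact: chain.1|exact: measurable0].
Qed.

Lemma measurable_sig_gt t n : measurable [set w | (t < sig n w)%R].
Proof.
have -> : [set w | (t < sig n w)%R] = setT `&` sig n @^-1` (`]t, +oo[)%classic.
  by rewrite setTI; apply/seteqP; split => w /=; rewrite in_itv/= andbT.
by apply: chain.2.1.
Qed.

Lemma measurable_forall_nat (Q : nat -> Prop) (B : nat -> set T) :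
  (forall k, measurable (B k)) -> measurable [set w | forall k, Q k -> B k w].
Proof.
move=> mB; have -> : [set w | forall k, Q k -> B k w] =
    \bigcap_k [set w | Q k -> B k w].
  by apply/seteqP; split => w /= H k; [move=> _; exact: H|exact: (H k I)].
apply: bigcapT_measurable => k.
have [Qk|nQk] := pselect (Q k).
  rewrite (_ : [set w | _] = B k)//.
  by apply/seteqP; split => w //=; exact.
rewrite (_ : [set w | _] = setT); first exact: measurableT.
by apply/seteqP; split => w //= _ /nQk.
Qed.

Lemma measurable_cylinder z m : measurable (cylinder z m).
Proof.
apply: (@measurableI _ _ [set w | forall k, (k <= m)%N -> Xt k w = z k]
  [set w | forall k, (1 <= k <= m)%N -> (0 < sig k w)%R]).
  by apply: measurable_forall_nat => k; exact: chain.1.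
by apply: measurable_forall_nat => k; exact: measurable_sig_gt.
Qed.

Lemma prob_cylinder z m : P (cylinder z m) = (path_weight z m)%:E.
Proof.
have := chain.2.2 m z (fun=> 0%R) (fun=> lexx _).
rewrite -/(cylinder z m) => ->; congr (_ * _)%:E.
by apply: eq_bigr => k _; rewrite mulr0 expR0 mulr1.
Qed.

(** In [is_CTMC] the time [sig m.+1] comes together with the jump that ends it, so its tail is read
    off with the next state [y] fixed. *)
Lemma prob_cylinder_tail z m y t : (0 <= t)%R ->
  P (cylinder (extend z m y) m.+1 `&` [set w | (t < sig m.+1 w)%R]) =
  (path_weight z m * Pjump G (z m) y * expR (- - G (z m) (z m) * t))%:E.
Proof.
(* All thresholds but the last are zero, so their exponential factors equal 1. *)
move=> t0; pose t' k := if k == m.+1 then t else 0%R.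
have t'0 k : (0 <= t' k)%R by rewrite /t'; case: ifP.
have H := chain.2.2 m.+1 (extend z m y) t' t'0.
transitivity (P [set w |
    (forall k, (k <= m.+1)%N -> Xt k w = extend z m y k) /\
    (forall k, (1 <= k <= m.+1)%N -> (t' k < sig k w)%R)]); last first.
  rewrite H -path_weight_extend /path_weight !big_nat_recr//=.
  rewrite /t' eqxx /extend leqnn ltnn !mulrA; congr (_ * _ * _)%:E%R.
  congr (_ * _)%R; apply: eq_big_nat => k /andP[_ km].
  by rewrite eqSS ltn_eqF// mulr0 expR0 mulr1.
congr (P _); apply/seteqP; split => w /=.
  move=> [[Hz Hs] ts]; split => // k km; rewrite /t'.
  by case: eqP => [->//|_]; exact: Hs.
move=> [Hz Hs]; split; first split=> // k km.
  by apply: le_lt_trans (Hs k km).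
by have := Hs m.+1; rewrite /t' eqxx leqnn; exact.
Qed.

(* The events of the right-hand side cover the left-hand one up to a null set,
   because both sides have the same probability; this also forces the holding
   times to be positive almost surely. *)
Lemma integral_cylinder_step z m (h : T -> \bar R) :
  measurable_fun setT h -> (forall w, 0 <= h w) ->
  \int[P]_(w in cylinder z m) h w =
  \esum_(y in [set: X]) \int[P]_(w in cylinder (extend z m y) m.+1) h w.
Proof.
move=> mh h0; pose F y := cylinder (extend z m y) m.+1.
have mF y : measurable (F y) := measurable_cylinder _ _.
have mU : measurable (\bigcup_y F y) by apply: countable_bigcupT_measurable => //; exact: countableP.
have tF : trivIset setT F.
  apply/trivIsetP => y y' _ _ yy'; apply/seteqP; split => w //= -[[H _] [H' _]].
  have := H m.+1 (leqnn _); rewrite (H' m.+1 (leqnn _)) /extend ltnn => E.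
  by move: yy'; rewrite E eqxx.
have FD : \bigcup_y F y `<=` cylinder z m.
  move=> w [y _ [Hz Hs]]; split => k km.
    by have := Hz k (leqW km); rewrite /extend km.
  by apply: Hs; case/andP: km => -> /leqW.
(* The weights of the one-step extensions add up to that of [z], as rows of [Pjump] sum to 1. *)
have PU : P (\bigcup_y F y) = P (cylinder z m).
  rewrite -[LHS]mul1e -integral_cst//= ge0_integral_bigcup_countType//=.
  under eq_esum => y _ do rewrite integral_cst//= mul1e prob_cylinder
    path_weight_extend EFinM.
  rewrite esumZl ?esum_Pjump ?mule1 ?path_weight_ge0 ?prob_cylinder//.
  by move=> y; rewrite lee_fin Pjump_ge0.
have mD := measurable_cylinder z m.
have PN : P (cylinder z m `\` \bigcup_y F y) = 0.
  rewrite measureD// ?setIidr//; last by rewrite ltey_eq fin_num_measure.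
  by rewrite [X in _ - X]PU subee// fin_num_measure.
rewrite (ge0_negligible_integral _ _ _ _ PN)//; first last.
- exact: measurable_funTS.
- exact: measurableD.
by rewrite setDD setIidr// ge0_integral_bigcup_countType.
Qed.

(** Brings an integral over the whole space into cylinder form: the cylinder of length zero at [x]
    has weight 1, so its complement is null. *)
Lemma integral_start (h : T -> \bar R) :
  measurable_fun setT h -> (forall w, 0 <= h w) ->
  \int[P]_w h w = \int[P]_(w in cylinder (fun=> x) 0) h w.
Proof.
move=> mh h0; have mD := measurable_cylinder (fun=> x) 0.
have PN : P (~` cylinder (fun=> x) 0) = 0.
  rewrite probability_setC// prob_cylinder /path_weight eqxx big_geq//.
  by rewrite mulr1 subee.
rewrite (ge0_negligible_integral _ _ _ _ PN)//; last exact: measurableC.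
by rewrite setTD setCK.
Qed.

(** After splitting over the next state, the exponential tail bound applies on each piece with
    parameter [- G (z m) (z m)], and the weights sum back to [path_weight z m]. *)
Lemma integral_holding_time z m :
  \int[P]_(w in cylinder z m) (Num.max (sig m.+1 w) 0)%:E <=
  (path_weight z m * ((- G (z m) (z m))^-1 * (1 - expR (-1))^-1))%:E.
Proof.
have S0 w : 0 <= (Num.max (sig m.+1 w) 0)%:E :> \bar R.
  by rewrite lee_fin le_max lexx orbT.
have msig := chain.2.1 m.+1.
rewrite integral_cylinder_step//; last first.
  by apply/measurable_EFinP; exact: measurable_maxr.
set K := (_^-1 * _)%R.
apply: (@le_trans _ _ (\esum_(y in [set: X])
    (path_weight z m * K)%:E * (Pjump G (z m) y)%:E)).
  apply: le_esum => y _; rewrite -EFinM mulrAC.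
  apply: integral_le_exponential_tail => //.
  - exact: measurable_cylinder.
  - by rewrite mulr_ge0 ?path_weight_ge0 ?Pjump_ge0.
  - by move=> t t0; exact: prob_cylinder_tail.
rewrite esumZl ?esum_Pjump ?mule1//.
- by move=> y; rewrite lee_fin Pjump_ge0.
- have e1 : (expR (-1) <= 1 :> R)%R by rewrite -[leRHS]expR0 ler_expR; lra.
  by rewrite mulr_ge0 ?path_weight_ge0// mulr_ge0 ?invr_ge0 ?subr_ge0// ltW.
Qed.

(** A cylinder of length [n] forces the first [n] holding times to be positive, and repeated
    splitting covers the space by such cylinders up to null sets. *)
Lemma ae_sig_gt0 : {ae P, forall w, forall k, (0 < sig k.+1 w)%R}.
Proof.
pose B N := [set w | forall k, (1 <= k <= N)%N -> (0 < sig k w)%R].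
have mB N : measurable (B N).
  by apply: measurable_forall_nat => k; exact: measurable_sig_gt.
have mI N : measurable_fun setT (fun w => (\1_(~` B N) w)%:E : \bar R).
  by apply/measurable_EFinP/measurable_indic/measurableC.
have I0 N w : 0 <= (\1_(~` B N) w)%:E :> \bar R by rewrite lee_fin.
(* Stated with [m + N] so that lengthening the cylinder by one step lowers [N] and keeps the event
   fixed. *)
have int0 N z m : \int[P]_(w in cylinder z m) (\1_(~` B (m + N)%N) w)%:E = 0.
  elim: N z m => [|N IH] z m.
    rewrite integral_indic; last exact: measurableC.
    rewrite addn0 (_ : _ `&` _ = set0) ?measure0//.
      by apply/seteqP; split => w //= [nB [_]]; exact: nB.
    exact: measurable_cylinder.
  rewrite integral_cylinder_step//; apply: esum1 => y _.
  by rewrite addnS -addSn IH.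
have PB N : P.-negligible (~` B N).
  apply/negligibleP; first exact: measurableC.
  have := int0 N (fun=> x) 0%N; rewrite add0n -integral_start//.
  rewrite integral_indic ?setIT//.
  exact: measurableC.
have := negligible_bigcup PB; apply: negligibleS => w /= /existsNP[k nk].
by exists k.+1 => //= Bk; apply: nk; apply: Bk; rewrite /= leqnn.
Qed.

(** * Time spent before entering [A], and its link to [zeta] *)

Context (A : set X) (f : X -> R) (eps : R).
Context (f_ge0 : forall y, (0 <= f y)%R) (fD : in_Dom G f) (eps_gt0 : (0 < eps)%R).
Context (f_drift : forall y, ~ A y -> (Gamma_apply G f y <= - eps)%R).

(** The stay in [Xt n] lasts [sig n.+1], hence the shift. Truncation at 0 keeps the function
    non-negative everywhere, as holding times are positive only almost surely. *)
Definition holding_outside (n : nat) (w : T) : \bar R :=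
  (Num.max (sig n.+1 w) 0 *
   \1_[set w | forall k, (k <= n)%N -> ~ A (Xt k w)] w)%:E.

Lemma holding_outside_ge0 n w : 0 <= holding_outside n w.
Proof. by rewrite lee_fin mulr_ge0// le_max lexx orbT. Qed.

Lemma measurable_holding_outside n : measurable_fun setT (holding_outside n).
Proof.
apply/measurable_EFinP/measurable_funM.
  by have := chain.2.1 n.+1 => msig; exact: measurable_maxr.
apply/measurable_indic/measurable_forall_nat => k.
exact: (measurable_visit (~` A) k).
Qed.

(* Induction on [N], conditioning on the first jump after the cylinder. *)
Lemma integral_holding_outside_le N z m :
  \int[P]_(w in cylinder z m) (\sum_(m <= n < m + N) holding_outside n w) <=
  (path_weight z m * ((1 - expR (-1))^-1 * (f (z m) / eps)))%:E.
Proof.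
have e1 : (0 <= (1 - expR (-1))^-1 :> R)%R.
  rewrite invr_ge0 subr_ge0 -[leRHS]expR0 ler_expR; lra.
have b0 y : (0 <= f y / eps)%R by rewrite mulr_ge0// invr_ge0 ltW.
have mcyl := measurable_cylinder z m.
set c := (1 - expR (-1))^-1%R in e1 *.
elim: N z m mcyl => [|N IH] z m mcyl.
  rewrite addn0; under eq_integral do rewrite big_geq//.
  by rewrite integral0 lee_fin mulr_ge0 ?path_weight_ge0// mulr_ge0.
(* If the path is in [A] at time [m], every indicator from [m] on vanishes. *)
have [Az|nAz] := pselect (A (z m)).
  rewrite [leLHS](_ : _ = 0); last first.
    apply: integral0_eq => w [Hz _].
    rewrite big_nat big1// => n /andP[mn _].
    rewrite /holding_outside indicE memNset ?mulr0// => /(_ m mn).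
    by rewrite Hz.
  by rewrite lee_fin mulr_ge0 ?path_weight_ge0// mulr_ge0.
under eq_integral do rewrite addnS big_ltn ?ltnS ?leq_addr// -addSn.
rewrite ge0_integralD//=; first last.
- apply: measurable_funTS; apply: emeasurable_sum => n.
  exact: measurable_holding_outside.
- by move=> w _; apply: sume_ge0 => n _; exact: holding_outside_ge0.
- by apply: measurable_funTS; exact: measurable_holding_outside.
- by move=> w _; exact: holding_outside_ge0.
have first_step : \int[P]_(w in cylinder z m) holding_outside m w <=
    (path_weight z m * ((- G (z m) (z m))^-1 * c))%:E.
  apply: le_trans (integral_holding_time z m).
  apply: ge0_le_integral => //.
  - by move=> w _; exact: holding_outside_ge0.
  - by apply: measurable_funTS; exact: measurable_holding_outside.
  - have := chain.2.1 m.+1 => msig; apply: measurable_funTS.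
    by apply/measurable_EFinP; exact: measurable_maxr.
  - by move=> w _; rewrite lee_fin ler_piMr ?le_max ?lexx ?orbT.
(* The induction hypothesis is applied after each possible jump; averaging [f] over the jump is
   where the drift condition enters. *)
have later_steps : \int[P]_(w in cylinder z m)
      (\sum_(m.+1 <= n < m.+1 + N) holding_outside n w) <=
    (path_weight z m * (c / eps))%:E * (f (z m) - eps / - G (z m) (z m))%:E.
  have pc : (0 <= path_weight z m * (c / eps))%R.
    by rewrite mulr_ge0 ?path_weight_ge0// divr_ge0// ltW.
  rewrite integral_cylinder_step; first last.
  - by move=> w; apply: sume_ge0 => n _; exact: holding_outside_ge0.
  - by apply: emeasurable_sum => n; exact: measurable_holding_outside.
  apply: (@le_trans _ _ (\esum_(y in [set: X])
      (path_weight z m * (c / eps))%:E * (Pjump G (z m) y * f y)%:E)).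
    apply: le_esum => y _; apply: le_trans (IH _ _ (measurable_cylinder _ _)) _.
    rewrite path_weight_extend /extend ltnn -EFinM lee_fin.
    rewrite le_eqVlt; apply/orP; left; apply/eqP.
    by field; rewrite gt_eqF.
  rewrite esumZl//; last by move=> y; rewrite lee_fin mulr_ge0// Pjump_ge0.
  apply: lee_wpmul2l; first by rewrite lee_fin.
  by apply: Pjump_drift => //; exact: f_drift.
(* Up to the factor [path_weight z m], and with [g := - G (z m) (z m)], the first stay costs [c / g]
   and the drift saves [(c / eps) * (eps / g)]. These cancel, leaving [c * (f (z m) / eps)]. *)
apply: le_trans (leeD first_step later_steps) _.
rewrite -EFinM -EFinD lee_fin le_eqVlt; apply/orP; left; apply/eqP.
by field; rewrite -(oppr_eq0 (G (z m) (z m))) !gt_eqF.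
Qed.

(** The cylinder bound started at [x] does not depend on [N], so it passes to the limit of the
    partial sums. *)
Lemma integral_sum_holding_outside_lty :
  \int[P]_w (\sum_(n <oo) holding_outside n w) < +oo.
Proof.
have mS N : measurable_fun setT
    (fun w => \sum_(0 <= n < N) holding_outside n w).
  by apply: emeasurable_sum => n; exact: measurable_holding_outside.
have S0 N w : 0 <= \sum_(0 <= n < N) holding_outside n w.
  by apply: sume_ge0 => n _; exact: holding_outside_ge0.
rewrite integral_nneseries//; first last.
- by move=> n w _; exact: holding_outside_ge0.
- exact: measurable_holding_outside.
apply: le_lt_trans (ltry ((1 - expR (-1))^-1 * (f x / eps)))%R.
apply: lime_le.
  apply: is_cvg_nneseries => n _ _.
  by apply: integral_ge0 => w _; exact: holding_outside_ge0.
apply: nearW => N.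
rewrite -ge0_integral_sum//; first last.
- by move=> n w _; exact: holding_outside_ge0.
- exact: measurable_holding_outside.
rewrite integral_start//.
apply: le_trans (integral_holding_outside_le N (fun=> x) 0) _.
by rewrite /path_weight eqxx big_geq// !mul1r.
Qed.

(** A visit to [A] at step [n] is seen at time [Jt sig n], because a positive [sig n.+1] gives the
    stay a nonempty interval; [tau] would then be finite. *)
Lemma avoid_of_tau_infty w : (forall k, (0 < sig k.+1 w)%R) ->
  tau Xt sig A w = +oo -> forall n, ~ A (Xt n w).
Proof.
move=> sig0 tauw n An.
suff : tau Xt sig A w <= (Jt sig n w)%:E by rewrite tauw leye_eq.
apply: ereal_inf_lbound; exists (Jt sig n w) => //=; split.
  by rewrite /Jt big_add1/= big_mkord; apply: sumr_ge0 => k _; exact: ltW.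
exists n; split => //; rewrite lexx/= /Jt [ltRHS]big_nat_recr//= ltrDl.
exact: sig0.
Qed.

Lemma zeta_ge0 w : 0 <= zeta sig w.
Proof.
by apply: ereal_sup_ubound; exists 0%N => //; rewrite /Jt big_geq.
Qed.

(** When [A] is never visited all indicators equal 1, so each [Jt sig n] is bounded by a partial sum
    of the series. *)
Lemma zeta_le_sum_holding_outside w : (forall k, (0 < sig k.+1 w)%R) ->
  (forall n, ~ A (Xt n w)) -> zeta sig w <= \sum_(n <oo) holding_outside n w.
Proof.
move=> sig0 nA; apply: ge_ereal_sup => _ [n _ <-].
apply: le_trans (nneseries_lim_ge n _); last first.
  by move=> k _ _; exact: holding_outside_ge0.
rewrite /Jt big_add1/= -sumEFin; apply: lee_sum => k _.
rewrite lee_fin indicE mem_set => [|j _ /=]; last exact: nA.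
by rewrite mulr1 le_max lexx.
Qed.

(** Domination of [zeta] by the series is known where all holding times are positive, hence almost
    surely; the comparison used asks for no measurability of [zeta] or of the event. *)
Lemma integral_zeta_lty :
  \int[P]_(w in [set w | tau Xt sig A w = +oo]) zeta sig w < +oo.
Proof.
apply: le_lt_trans integral_sum_holding_outside_lty.
rewrite integral_mkcond; apply: ae_ge0_le_integral_nonmeasurable.
- by move=> w; apply: erestrict_ge0 => ? _; exact: zeta_ge0.
- by move=> w; apply: nneseries_ge0 => n _ _; exact: holding_outside_ge0.
- apply: ge0_emeasurable_sum => n *; first exact: holding_outside_ge0.
  exact: measurable_holding_outside.
apply: filterS ae_sig_gt0 => w sig0; rewrite patchE; case: ifPn.
  rewrite inE => /avoid_of_tau_infty; move/(_ sig0).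
  exact: zeta_le_sum_holding_outside.
by move=> _; apply: nneseries_ge0 => n _ _; exact: holding_outside_ge0.
Qed.

End Chain.

Theorem theorem1p4 (R : realType) (X : countType) (G : X -> X -> R)
  (HXinf : infinite_set [set: X])
  (Hoff : forall x y : X, y != x -> 0 <= G x y)
  (Hgam : forall x : X, gam G x = (- G x x)%:E)
  (Hgpos : forall x : X, 0 < - G x x)
  (Hirr : irreducible_P G)
  (A : set X) (HA : A != setT)
  (f : X -> R) (Hf0 : forall x, 0 <= f x) (HfD : in_Dom G f)
  (Hi : exists2 x0, ~ A x0 & ((f x0)%:E < ereal_inf [set (f y)%:E | y in A])%E)
  (eps : R) (Heps : 0 < eps)
  (Hii : forall x, ~ A x -> Gamma_apply G f x <= - eps)
  (d : measure_display) (T : measurableType d) (P : probability T R)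
  (x : X) (Xt : nat -> T -> X) (sig : nat -> T -> R)
  (Hchain : is_CTMC P G x Xt sig)
  (Hpos : (0 < P [set w | tau Xt sig A w = +oo])%E) :
  (cond_expect P (zeta sig) [set w | tau Xt sig A w = +oo] < +oo)%E.
Proof.
have fin : (\int[P]_(w in [set w | tau Xt sig A w = +oo]) zeta sig w < +oo)%E.
  exact: (integral_zeta_lty _ _ _ _ _ Hoff Hgam Hgpos Hchain _ _ _ Hf0 HfD Heps Hii).
have ge0 : (0 <= \int[P]_(w in [set w | tau Xt sig A w = +oo]) zeta sig w)%E.
  by apply: integral_ge0 => w _; exact: zeta_ge0.
(* A non-negative integral below [+oo] is a real number, and so is its product with the real factor
   [(fine (P B))^-1], where [B] is the conditioning event. *)
rewrite /cond_expect; move: fin ge0.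
by case: integral => [r| |]//= _ _; rewrite -EFinM ltry.
Qed.
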